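(* For every positive integer $m$, $\omega_0(P_m)=\left\lceil \frac{m(m-1)}{4}\right\rceil$, where $P_m$ is the path with $m$ vertices.
   Context: The path $P_m$ is the graph with vertices $v_1,\dots,v_m$ and edges $\{v_i,v_{i+1}\}$ for $1\le i\le m-1$, regarded as a hypergraph $(\mathcal V,\mathcal E)$ whose hyperedges are its edges. An edge-discriminator on a hypergraph $\mathcal H=(\mathcal V,\mathcal E)$ is a function $\lambda:\mathcal V\to\mathbb Z^{+}\cup\{0\}$ such that $\sum_{v\in E}\lambda(v)>0$ for every $E\in\mathcal E$, and $\sum_{v\in E}\lambda(v)\ne\sum_{v\in E'}\lambda(v)$ for every two distinct $E,E'\in\mathcal E$. Its weight is $\omega_\lambda(\mathcal V)=\sum_{v\in\mathcal V}\lambda(v)$. The quantity $\omega_0(\mathcal H)$ is the minimum of $\omega_\lambda(\mathcal V)$ over all edge-discriminators $\lambda$ on $\mathcal H$. *)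

(* Defs.v *)
From mathcomp Require Import all_boot all_order all_algebra.
From mathcomp Require Import boolp.

Set Implicit Arguments.
Unset Strict Implicit.
Unset Printing Implicit Defensive.

(* Hyperedges are required to be nonempty: an empty hyperedge has sum 0, so it
   would rule out every edge-discriminator and [omega0] would not exist. *)
Record hypergraph (V : finType) := Hypergraph {
  hyperedges : {set {set V}};
  hyperedges_neq0 : set0 \notin hyperedges }.

Definition edge_sum (V : finType) (lam : V -> nat) (E : {set V}) : nat :=
  \sum_(v in E) lam v.

Definition edge_discriminator (V : finType) (H : hypergraph V)
    (lam : V -> nat) : Prop :=
  (forall E, E \in hyperedges H -> 0 < edge_sum lam E) /\
  (forall E E', E \in hyperedges H -> E' \in hyperedges H -> E <> E' ->
     edge_sum lam E <> edge_sum lam E').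

Definition weight (V : finType) (lam : V -> nat) : nat := \sum_(v : V) lam v.

Definition discriminator_weight (V : finType) (H : hypergraph V) (w : nat) :
    Prop :=
  exists2 lam : V -> nat, edge_discriminator H lam & weight lam = w.

Lemma subset_sum_pow2_inj (n : nat) (P Q : pred nat) :
  \sum_(0 <= i < n | P i) 2 ^ i = \sum_(0 <= i < n | Q i) 2 ^ i ->
  forall i, i < n -> P i = Q i.
Proof.
elim: n P Q => // n IHn P Q.
rewrite big_mkcond [RHS]big_mkcond /= !big_nat_recl //=.
have shift (R : pred nat) :
    \sum_(0 <= i < n) (if R i.+1 then 2 ^ i.+1 else 0) =
    (\sum_(0 <= i < n | R i.+1) 2 ^ i).*2.
  rewrite [in RHS]big_mkcond -mul2n big_distrr /=; apply: eq_bigr => i _.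
  by case: (R _); rewrite ?expnS ?muln0.
rewrite !shift => eqPQ.
have eq0 : P 0 = Q 0.
  by move/(congr1 odd): eqPQ; rewrite !oddD !odd_double; case: (P 0); case: (Q 0).
move: eqPQ; rewrite eq0 => /addnI/double_inj/(IHn (P \o succn) (Q \o succn)) IH.
by case=> [|i] // /IH.
Qed.

Lemma edge_sum_pow2 (V : finType) (E : {set V}) :
  edge_sum (fun v => 2 ^ enum_rank v) E =
  \sum_(0 <= i < #|V| | [exists v in E, enum_rank v == i :> nat]) 2 ^ i.
Proof.
rewrite big_mkord /edge_sum (reindex_onto (@enum_val V V) enum_rank) /=; last first.
  by move=> v _; apply: enum_rankK.
apply: eq_big => [i|i _]; rewrite enum_valK // eqxx andbT.
apply/idP/existsP => [Ei|[v /andP[Ev /eqP/val_inj <-]]]; last by rewrite enum_rankK.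
by exists (enum_val i); rewrite Ei enum_valK eqxx.
Qed.

Lemma ex_discriminator_weight (V : finType) (H : hypergraph V) :
  exists w, `[< discriminator_weight H w >].
Proof.
pose lam (v : V) := 2 ^ enum_rank v.
exists (weight lam); apply/asboolP; exists lam => //; split=> [E EH|E E' _ _ neqE].
  have [v Ev] : exists v, v \in E.
    by apply/set0Pn; apply: contraNneq (hyperedges_neq0 H) => <-.
  by rewrite /edge_sum (bigD1 v) //= addn_gt0 expn_gt0.
rewrite !edge_sum_pow2 => eqS; apply: neqE; apply/setP => v.
have mem (F : {set V}) :
    [exists u in F, enum_rank u == enum_rank v :> nat] = (v \in F).
  apply/existsP/idP => [[u /andP[Fu /eqP/val_inj/enum_rank_inj <-]] //|Fv].
  by exists v; rewrite Fv eqxx.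
by rewrite -!mem; apply: (subset_sum_pow2_inj eqS (ltn_ord (enum_rank v))).
Qed.

Definition omega0 (V : finType) (H : hypergraph V) : nat :=
  ex_minn (ex_discriminator_weight H).

Lemma omega0P (V : finType) (H : hypergraph V) :
  discriminator_weight H (omega0 H) /\
  (forall lam, edge_discriminator H lam -> omega0 H <= weight lam).
Proof.
rewrite /omega0; case: ex_minnP => w /asboolP Hw wmin; split=> // lam Hlam.
by apply: wmin; apply/asboolP; exists lam.
Qed.

(* The vertex v_(i+1) is represented by the ordinal i. *)
Definition path_edges (m : nat) : {set {set 'I_m}} :=
  [set [set p.1; p.2] | p : 'I_m * 'I_m & p.2 == p.1.+1 :> nat].

Lemma path_edges_neq0 (m : nat) : set0 \notin path_edges m.
Proof.
apply/imsetP => -[p _ /setP/(_ p.1)].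
by rewrite !inE eqxx.
Qed.

Definition path_graph (m : nat) : hypergraph 'I_m :=
  Hypergraph (path_edges_neq0 m).

(* Main.v *)
Require Import Defs.
From mathcomp Require Import all_boot all_order all_algebra.
From mathcomp Require Import zify lra.

(** In a discriminator on [P_(n+1)] the [n] edge sums are distinct and positive,
    so they add up to at least [n(n+1)/2]; they also add up to twice the weight
    minus the labels of the two end vertices.  Equality up to rounding holds as
    soon as the edge sums are exactly [1, ..., n] and the end labels add up to
    at most 1.  This is achieved by listing the odd edge sums increasingly, then
    the even ones decreasingly: [1, 3, 5, ..., 6, 4, 2], starting from the
    label 0. *)

Set Implicit Arguments.
Unset Strict Implicit.
Unset Printing Implicit Defensive.

Import Order.TTheory GRing.Theory Num.Theory.

(** Counting from 1, the [i]-th entry is at least [x + i]. Doubling avoids a division, and a free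
    [x] lets the induction restart from the head. *)
Lemma path_ltn_sumn x s :
  path ltn x s -> size s * (size s).+1 + (size s * x).*2 <= (sumn s).*2.
Proof.
elim: s x => [|y s IHs] x //= /andP[ltxy /IHs {IHs}]; move: (size s) (sumn s).
by move=> k t; have := leq_mul (leqnn k) ltxy; nia.
Qed.

Lemma sumn_uniq_pos s :
  uniq s -> all (ltn 0) s -> size s * (size s).+1 <= (sumn s).*2.
Proof.
move=> us s0; rewrite -(size_sort leq) -(perm_sumn (permEl (perm_sort leq s))).
have: path ltn 0 (sort leq s).
  rewrite path_min_sorted ?all_sort // ltn_sorted_uniq_leq sort_uniq us /=.
  exact: (sort_sorted leq_total).
by move/path_ltn_sumn; rewrite muln0 addn0.
Qed.

(** By pigeonhole, [s] is a permutation of [1, ..., size s]. *)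
Lemma sumn_uniq_bounded s :
  uniq s -> all (fun x => 0 < x <= size s) s ->
  (sumn s).*2 = size s * (size s).+1.
Proof.
move=> us s_bnd.
have sub : {subset s <= iota 1 (size s)}.
  by move=> x /(allP s_bnd); rewrite mem_iota add1n ltnS.
have [_ eqs] := uniq_min_size us sub (eq_leq (size_iota _ _)).
rewrite (perm_sumn (uniq_perm us (iota_uniq _ _) eqs)).
elim: (size s) => // n IHn.
by rewrite -(addn1 n) iotaD sumn_cat /= doubleD IHn; lia.
Qed.

Section PathEdges.

Variable n : nat.

Definition path_edge (i : 'I_n) : {set 'I_n.+1} :=
  [set widen_ord (leqnSn n) i; lift ord0 i].

Definition path_edge_sum (lam : 'I_n.+1 -> nat) (i : 'I_n) : nat :=
  lam (widen_ord (leqnSn n) i) + lam (lift ord0 i).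

Lemma mem_path_edge i : path_edge i \in path_edges n.+1.
Proof.
by apply/imsetP; exists (widen_ord (leqnSn n) i, lift ord0 i); rewrite ?inE.
Qed.

Lemma path_edgesP E : E \in path_edges n.+1 -> exists i, E = path_edge i.
Proof.
case/imsetP=> -[u v]; rewrite inE /= => /eqP uv ->.
have ltun : u < n by rewrite -ltnS -uv.
exists (Ordinal ltun); rewrite /path_edge.
by congr [set _; _]; apply: val_inj; rewrite /= ?uv.
Qed.

(** The lower end of each edge lies in the other, so [i] is [j] or [j + 1] and [j] is [i] or
    [i + 1]; hence [i = j]. *)
Lemma path_edge_inj : injective path_edge.
Proof.
move=> i j eqij; apply: val_inj => /=.
have: widen_ord (leqnSn n) i \in path_edge j by rewrite -eqij !inE eqxx.
have: widen_ord (leqnSn n) j \in path_edge i by rewrite eqij !inE eqxx.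
rewrite !inE -!val_eqE /= /bump /=; lia.
Qed.

Lemma edge_sum_path_edge lam i :
  edge_sum lam (path_edge i) = path_edge_sum lam i.
Proof.
by rewrite /edge_sum big_setU1 ?big_set1 //= inE -val_eqE /= /bump; lia.
Qed.

Lemma path_discriminatorP (lam : 'I_n.+1 -> nat) :
  edge_discriminator (path_graph n.+1) lam <->
  (forall i, 0 < path_edge_sum lam i) /\ injective (path_edge_sum lam).
Proof.
split=> [[pos neq]|[pos inj]]; split.
- by move=> i; rewrite -edge_sum_path_edge pos ?mem_path_edge.
- move=> i j; rewrite -!edge_sum_path_edge => eqs; apply: path_edge_inj.
  apply/eqP/negP => /negP/eqP neqE.
  exact: neq (mem_path_edge i) (mem_path_edge j) neqE eqs.
- by move=> E /path_edgesP[i ->]; rewrite edge_sum_path_edge.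
- move=> E E' /path_edgesP[i ->] /path_edgesP[j ->] neqE.
  by rewrite !edge_sum_path_edge => /inj eqij; apply: neqE; rewrite eqij.
Qed.

Lemma double_weight_path (lam : 'I_n.+1 -> nat) :
  (weight lam).*2 =
  sumn [seq path_edge_sum lam i | i : 'I_n] + (lam ord0 + lam ord_max).
Proof.
have -> : sumn [seq path_edge_sum lam i | i : 'I_n] =
    \sum_i path_edge_sum lam i.
  by rewrite sumnE big_map big_enum.
(* Splitting off the last vertex, then the first, matches the lower and upper ends of the edges. *)
have wl : weight lam = \sum_i lam (widen_ord (leqnSn n) i) + lam ord_max.
  exact: big_ord_recr.
have wr : weight lam = lam ord0 + \sum_i lam (lift ord0 i).
  exact: big_ord_recl.
rewrite -addnn {1}wl wr big_split /= [X in _ + X]addnC addnACA.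
by rewrite [lam ord_max + _]addnC.
Qed.

Lemma weight_path_ge (lam : 'I_n.+1 -> nat) :
  edge_discriminator (path_graph n.+1) lam -> n * n.+1 <= 4 * weight lam.
Proof.
case/path_discriminatorP=> pos inj.
have := @sumn_uniq_pos [seq path_edge_sum lam i | i : 'I_n].
rewrite size_map -cardE card_ord (map_inj_uniq inj) enum_uniq => /(_ isT).
have -> : all (ltn 0) [seq path_edge_sum lam i | i : 'I_n].
  by apply/allP => _ /mapP[i _ ->]; apply: pos.
by move/(_ isT); have := double_weight_path lam; lia.
Qed.

(* The unique labelling starting at 0 whose successive edge sums are
   1, 3, 5, ..., 6, 4, 2. *)
Definition zigzag_label (v : 'I_n.+1) : nat :=
  let k := (n.+1)./2 in
  if v <= k then v : nat else n - v + (odd (n - v) (+) odd k).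

(** Beyond [k = (n.+1)./2] the parity bit alternates, so two neighbours contribute
    [(n - i) + (n - i.+1) + 1]. The shift [odd k] makes both branches of the label agree at [v = k],
    which settles the edge [i = k]. *)
Lemma zigzag_label_sum i :
  path_edge_sum zigzag_label i = if i < (n.+1)./2 then i.*2.+1 else (n - i).*2.
Proof.
rewrite /path_edge_sum /zigzag_label /= /bump add1n.
have := ltn_ord i; move: (nat_of_ord i) => {}i ltin.
have := odd_double_half n.+1; case: (ltngtP i (uphalf n)); lia.
Qed.

(** Parity separates the two branches, and each branch is injective. *)
Lemma zigzag_label_discriminator :
  edge_discriminator (path_graph n.+1) zigzag_label.
Proof.
apply/path_discriminatorP; split=> [i|i j].
  by rewrite zigzag_label_sum; have := ltn_ord i; case: ifP; lia.
rewrite !zigzag_label_sum => eqs; apply: val_inj => /=; move: eqs.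
by have := ltn_ord i; have := ltn_ord j; do 2![case: ifP => _]; lia.
Qed.

Lemma weight_zigzag_label : 4 * weight zigzag_label <= n * n.+1 + 2.
Proof.
have [_ inj] := (path_discriminatorP _).1 zigzag_label_discriminator.
have := @sumn_uniq_bounded [seq path_edge_sum zigzag_label i | i : 'I_n].
rewrite size_map -cardE card_ord (map_inj_uniq inj) enum_uniq => /(_ isT).
have -> : all (fun x => 0 < x <= n)
    [seq path_edge_sum zigzag_label i | i : 'I_n].
  apply/allP => _ /mapP[i _ ->]; rewrite zigzag_label_sum.
  by have := ltn_ord i; case: ifP; lia.
move/(_ isT); have := double_weight_path zigzag_label.
have -> : zigzag_label ord0 = 0 by [].
(* The first branch occurs only if [n <= (n.+1)./2], that is [n <= 1]; in the second only the parity
   bit remains. *)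
have : zigzag_label ord_max <= 1.
  rewrite /zigzag_label /= subnn /=.
  by case: ifP => [|_]; [lia | case: (odd _)].
lia.
Qed.

End PathEdges.

Theorem theorem1p2 (m : nat) (hm : (0 < m)%N) :
  ((omega0 (path_graph m))%:Z = Num.ceil (m%:R * (m%:R - 1) / 4%:R : rat))%R.
Proof.
case: m hm => // n _.
have [[lam /weight_path_ge + <-] /(_ _ (zigzag_label_discriminator n))] :=
  omega0P (path_graph n.+1).
move: (weight lam) => w lb /(leq_mul (leqnn 4)) le_w.
have ub := leq_trans le_w (weight_zigzag_label n).
move: lb ub; rewrite -!(ler_nat rat) !(natrM, natrD) -[n.+1%:R%R]natr1 => lb ub.
(* From [n * n.+1 <= 4 * w <= n * n.+1 + 2] and [2 < 4], the quotient lies in the interval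
   [(w - 1, w]]. *)
apply/esym/ceil_def/andP; split; rewrite ?rmorphB /= -?pmulrn; lra.
Qed.
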